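(* Let $f\in\mathbb{Q}(x)$, let $d\ge 1$ be an integer with $d>1$, and let $\alpha\in R=\mathbb{Z}[\mathbb{Z}^\circ]$. Suppose there exists $\beta\in\operatorname{Ann}_R(f)$ such that $\phi_d(\alpha)=\phi_d(\beta)$ and $f$ is defined at $\zeta_d^a$ for each $a\in\operatorname{Supp}(\alpha)\cup\operatorname{Supp}(\beta)$. Then $\Phi_d$ is a factor of $\alpha f$.
   Context: $\mathbb{Z}^\circ$ is the multiplicative monoid of nonzero integers, and $R=\mathbb{Z}[\mathbb{Z}^\circ]$ is its integral monoid ring: finite formal sums $\alpha=\sum_m a_m[m]$ with $a_m\in\mathbb{Z}$, and multiplication extending $[m][n]=[mn]$. $\operatorname{Supp}(\alpha)=\{m : a_m\neq 0\}$. $R$ acts on $\mathbb{Q}(x)$ by $(\alpha f)(x)=\sum_m a_m f(x^m)$, and $\operatorname{Ann}_R(f)=\{r\in R : rf=0\}$. $(\mathbb{Z}/d)^\circ$ is the multiplicative monoid of all residue classes mod $d$ (including $0$), and $\phi_d:\mathbb{Z}[\mathbb{Z}^\circ]\to\mathbb{Z}[(\mathbb{Z}/d)^\circ]$ is the ring homomorphism induced by $[m]\mapsto[m \bmod d]$. $\zeta_d$ is a primitive $d$-th root of unity in $\mathbb{C}$ and $\Phi_d$ is the $d$-th cyclotomic polynomial. $F\in\mathbb{Q}(x)$ is defined at $\xi\in\mathbb{C}$ if $\xi$ is not a pole of $F$. $\Phi_d$ is a factor of $F$ if $F=P/Q$ with $P,Q\in\mathbb{Q}[x]$, $\Phi_d\mid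 P$ and $\Phi_d\nmid Q$; equivalently, $F$ is defined at $\zeta_d$ and $F(\zeta_d)=0$. *)

(* Defs.v *)
From HB Require Import structures.
From mathcomp Require Import all_boot all_order all_algebra all_field.
From mathcomp Require Import finmap.
From mathcomp.multinomials Require Import monalg.
From mathcomp.real_closed Require Import complex.
From mathcomp Require Import reals.

Set Implicit Arguments.
Unset Strict Implicit.
Unset Printing Implicit Defensive.

Import GRing.Theory Num.Theory.
Local Open Scope fset_scope.
Local Open Scope ring_scope.

(* The ring structure that monalg puts on {malg int[M]} is not usable here: its
   [monomType] requires that only 1 be invertible, which fails for the nonzero
   integers.  Only the underlying free abelian group is reused. *)
Definition monoid_ring (M : monoidType) : Type := {malg int[M]}.

HB.instance Definition _ (M : monoidType) :=
  GRing.Zmodule.copy (monoid_ring M) {malg int[M]}.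

Section MonoidRing.
Variable M : monoidType.
Implicit Types (g : monoid_ring M) (k : M).

Definition bracket (c : int) k : monoid_ring M := mkmalgU k c.

Definition mr_one : monoid_ring M := bracket 1 1%g.

Definition mr_mul g1 g2 : monoid_ring M :=
  \sum_(k1 <- msupp g1) \sum_(k2 <- msupp g2)
    bracket (g1@_k1 * g2@_k2) (k1 * k2)%g.

Lemma bracket0 k : bracket 0 k = 0.
Proof. exact: monalgU0. Qed.

Lemma bracketD k c1 c2 : bracket (c1 + c2) k = bracket c1 k + bracket c2 k.
Proof. exact: monalgUD. Qed.

Lemma mr_mulw (d1 d2 : {fset M}) g1 g2 :
  msupp g1 `<=` d1 -> msupp g2 `<=` d2 ->
  mr_mul g1 g2 = \sum_(k1 <- d1) \sum_(k2 <- d2)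
    bracket (g1@_k1 * g2@_k2) (k1 * k2)%g.
Proof.
move=> le_d1 le_d2; rewrite /mr_mul (big_fset_incl _ le_d1) /=.
  apply/eq_bigr=> k1 _; apply/big_fset_incl => // k _ /mcoeff_outdom ->.
  by rewrite mulr0 bracket0.
move=> k _ /mcoeff_outdom g1k.
by rewrite big1 // => k' _; rewrite g1k mul0r bracket0.
Qed.

Lemma mr_mul0g : left_zero 0 mr_mul.
Proof. by move=> g; rewrite /mr_mul msupp0 big_seq_fset0. Qed.

Lemma mr_mulg0 : right_zero 0 mr_mul.
Proof.
move=> g; rewrite /mr_mul big1 // => k _.
by rewrite msupp0 big_seq_fset0.
Qed.

Lemma mr_mulDl : left_distributive mr_mul +%R.
Proof.
move=> g1 g2 g.
rewrite [mr_mul g1 g](mr_mulw (fsubsetUl _ (msupp g2)) (fsubset_refl _)).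
rewrite [mr_mul g2 g](mr_mulw (fsubsetUr (msupp g1) _) (fsubset_refl _)).
rewrite (mr_mulw (msuppD_le _ _) (fsubset_refl _)).
rewrite -big_split /=; apply/eq_bigr=> k1 _.
rewrite -big_split /=; apply/eq_bigr=> k2 _.
by rewrite mcoeffD mulrDl bracketD.
Qed.

Lemma mr_mulDr : right_distributive mr_mul +%R.
Proof.
move=> g g1 g2.
rewrite [mr_mul g g1](mr_mulw (fsubset_refl _) (fsubsetUl _ (msupp g2))).
rewrite [mr_mul g g2](mr_mulw (fsubset_refl _) (fsubsetUr (msupp g1) _)).
rewrite (mr_mulw (fsubset_refl _) (msuppD_le _ _)).
rewrite -big_split /=; apply/eq_bigr=> k1 _.
rewrite -big_split /=; apply/eq_bigr=> k2 _.
by rewrite mcoeffD mulrDr bracketD.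
Qed.

Lemma mr_mulUU c1 c2 k1 k2 :
  mr_mul (bracket c1 k1) (bracket c2 k2) = bracket (c1 * c2) (k1 * k2)%g.
Proof. by rewrite (mr_mulw msuppU_le msuppU_le) !big_seq_fset1 !mcoeffUU. Qed.

Lemma mr_E g : g = \sum_(k <- msupp g) bracket g@_k k.
Proof. exact: monalgE. Qed.

Lemma mr_mul_suml (I : Type) (r : seq I) (F : I -> monoid_ring M) g :
  mr_mul (\sum_(i <- r) F i) g = \sum_(i <- r) mr_mul (F i) g.
Proof. exact: (big_morph (mr_mul^~ g) (fun _ _ => mr_mulDl _ _ _) (mr_mul0g _)). Qed.

Lemma mr_mul_sumr (I : Type) (r : seq I) (F : I -> monoid_ring M) g :
  mr_mul g (\sum_(i <- r) F i) = \sum_(i <- r) mr_mul g (F i).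
Proof. exact: (big_morph (mr_mul g) (fun _ _ => mr_mulDr _ _ _) (mr_mulg0 _)). Qed.

Lemma mr_mul1g : left_id mr_one mr_mul.
Proof.
move=> g; rewrite {1}[g]mr_E mr_mul_sumr [RHS]mr_E.
by apply/eq_bigr => k _; rewrite mr_mulUU mul1r mul1g.
Qed.

Lemma mr_mulg1 : right_id mr_one mr_mul.
Proof.
move=> g; rewrite {1}[g]mr_E mr_mul_suml [RHS]mr_E.
by apply/eq_bigr => k _; rewrite mr_mulUU mulr1 mulg1.
Qed.

Lemma mr_mulA : associative mr_mul.
Proof.
move=> g1 g2 g3; rewrite [g1]mr_E !mr_mul_suml; apply/eq_bigr => k1 _.
rewrite [g2]mr_E mr_mul_suml !mr_mul_sumr mr_mul_suml; apply/eq_bigr => k2 _.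
rewrite [g3]mr_E !mr_mul_sumr; apply/eq_bigr => k3 _.
by rewrite !mr_mulUU mulrA mulgA.
Qed.

Lemma mr_one_neq0 : mr_one != 0.
Proof. by rewrite monalgU_eq0 oner_eq0. Qed.

HB.instance Definition _ := GRing.Zmodule_isNzRing.Build (monoid_ring M)
  mr_mulA mr_mul1g mr_mulg1 mr_mulDl mr_mulDr mr_one_neq0.

End MonoidRing.

Definition supp (M : monoidType) (g : monoid_ring M) : {fset M} := msupp g.

Section Functoriality.
Variables (M N : monoidType) (h : M -> N).

Definition mr_map (g : monoid_ring M) : monoid_ring N :=
  \sum_(k <- msupp g) bracket g@_k (h k).

Lemma mr_mapw (d : {fset M}) (g : monoid_ring M) : msupp g `<=` d ->
  mr_map g = \sum_(k <- d) bracket g@_k (h k).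
Proof.
move=> le_d; rewrite /mr_map; apply: big_fset_incl => //= k _ /mcoeff_outdom ->.
by rewrite bracket0.
Qed.

Lemma mr_map_is_zmod_morphism : zmod_morphism mr_map.
Proof.
move=> g1 g2; rewrite (mr_mapw (msuppB_le _ _)).
rewrite (mr_mapw (fsubsetUl (msupp g1) (msupp g2))).
rewrite (mr_mapw (fsubsetUr (msupp g1) (msupp g2))).
rewrite -sumrB; apply/eq_bigr => k _.
by rewrite mcoeffB /bracket monalgUB.
Qed.

HB.instance Definition _ := GRing.isZmodMorphism.Build
  (monoid_ring M) (monoid_ring N) mr_map mr_map_is_zmod_morphism.

Lemma mr_map_bracket c k : mr_map (bracket c k) = bracket c (h k).
Proof. by rewrite (mr_mapw msuppU_le) big_seq_fset1 mcoeffUU. Qed.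

Hypothesis h1 : h 1%g = 1%g.
Hypothesis hM : {morph h : x y / (x * y)%g}.

Lemma mr_map_monoid_morphism : GRing.monoid_morphism mr_map.
Proof.
split=> [|g1 g2]; first by rewrite mr_map_bracket h1.
rewrite [g1]mr_E mulr_suml !raddf_sum mulr_suml; apply/eq_bigr => k1 _ /=.
rewrite [g2]mr_E mulr_sumr !raddf_sum mulr_sumr; apply/eq_bigr => k2 _ /=.
by rewrite [bracket _ _ * _]mr_mulUU !mr_map_bracket hM; apply/esym/mr_mulUU.
Qed.

End Functoriality.

(* The multiplicative monoid of all elements of a ring, as an alias so that it
   does not clash with the additive group structure of 'Z_d. *)
Definition mulmonoid (A : pzRingType) : Type := A.

HB.instance Definition _ (A : pzRingType) := Choice.copy (mulmonoid A) A.
HB.instance Definition _ (A : pzRingType) :=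
  isMonoid.Build (mulmonoid A) (@mulrA A) (@mul1r A) (@mulr1 A).

Definition nzint : Type := {m : int | m != 0}.

HB.instance Definition _ := Choice.on nzint.

Definition nzint_one : nzint := exist _ 1 isT.
Definition nzint_mul (m n : nzint) : nzint :=
  exist _ (val m * val n) (mulf_neq0 (valP m) (valP n)).

Lemma nzint_mulA : associative nzint_mul.
Proof. by move=> m n p; apply: val_inj; rewrite /= mulrA. Qed.
Lemma nzint_mul1 : left_id nzint_one nzint_mul.
Proof. by move=> m; apply: val_inj; rewrite /= mul1r. Qed.
Lemma nzint_mulr1 : right_id nzint_one nzint_mul.
Proof. by move=> m; apply: val_inj; rewrite /= mulr1. Qed.

HB.instance Definition _ :=
  isMonoid.Build nzint nzint_mulA nzint_mul1 nzint_mulr1.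

Notation ZZo := (monoid_ring nzint).

(* 'Z_d is Z/d only for d > 1. *)
Definition residue (d : nat) (m : nzint) : mulmonoid 'Z_d := (val m)%:~R.

Definition phi (d : nat) : ZZo -> monoid_ring (mulmonoid 'Z_d) :=
  mr_map (residue d).

HB.instance Definition _ d := GRing.Additive.on (phi d).

Lemma phi_monoid_morphism d : GRing.monoid_morphism (phi d).
Proof.
by apply: mr_map_monoid_morphism => // m n; rewrite /residue /= rmorphM.
Qed.

HB.instance Definition _ d :=
  GRing.isMonoidMorphism.Build _ _ (phi d) (phi_monoid_morphism d).

Notation ratfun := {fraction {poly rat}}.

Local Notation "p %:F" := (@FracField.tofrac {poly rat} p).

Definition eval_ratfun (P : {poly rat}) (y : ratfun) : ratfun :=
  (map_poly (fun c : rat => c%:P%:F) P).[y].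

(* F(x^m), computed on a representative P/Q of F as P(x^m) / Q(x^m) *)
Definition subst_pow (m : int) (F : ratfun) : ratfun :=
  let xm := ('X%:F : ratfun) ^ m in
  eval_ratfun (frac (repr F)).1 xm / eval_ratfun (frac (repr F)).2 xm.

Definition act (alpha : ZZo) (f : ratfun) : ratfun :=
  \sum_(m <- supp alpha) subst_pow (val m) f *~ alpha@_m.

Definition Ann (f : ratfun) (r : ZZo) : Prop := act r f = 0.

Definition is_pole (C : fieldType) (F : ratfun) (xi : C) : Prop :=
  exists P Q : {poly rat},
    [/\ Q != 0, coprimep P Q, F = P%:F / Q%:F & root (map_poly ratr Q) xi].

Definition defined_at (C : fieldType) (F : ratfun) (xi : C) : Prop :=
  ~ is_pole F xi.

Definition is_factor (Phi : {poly rat}) (F : ratfun) : Prop :=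
  exists P Q : {poly rat}, [/\ F = P%:F / Q%:F, Phi %| P & ~~ (Phi %| Q)].

Definition Phi_rat (d : nat) : {poly rat} := map_poly intr 'Phi_d.

(* Main.v *)
Require Import Defs.
From HB Require Import structures.
From mathcomp Require Import all_boot all_order all_algebra all_field.
From mathcomp Require Import finmap.
From mathcomp.multinomials Require Import monalg.
From mathcomp.real_closed Require Import complex.
From mathcomp Require Import reals.

(** The rational functions defined at [zeta] form a local ring with an
    evaluation map, and [(alpha f)(zeta) = \sum_m alpha_m f(zeta^m)].  Since
    [f(zeta^m)] depends only on [m] mod [d], this sum depends only on
    [phi_d(alpha)]; it therefore equals [(beta f)(zeta) = 0].  As [Phi_d] is
    the minimal polynomial of [zeta], it divides the numerator of [alpha f] and
    not the denominator. *)

Set Implicit Arguments.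
Unset Strict Implicit.
Unset Printing Implicit Defensive.

Import GRing.Theory Num.Theory.
Local Open Scope fset_scope.
Local Open Scope ring_scope.

Local Notation "p %:F" := (@FracField.tofrac {poly rat} p).
(* The embedding used by [eval_ratfun] is eta-expanded; this form carries the
   ring morphism structure. *)
Local Notation constF := (@FracField.tofrac {poly rat} \o polyC).
Local Notation "p .<[ x ]>" := (map_poly ratr p).[x]
  (at level 2, left associativity, format "p .<[ x ]>").

(** * Reduced fractions *)

Lemma fraction_repr (A : idomainType) (x : {fraction A}) :
  x = FracField.tofrac (frac (repr x)).1 / FracField.tofrac (frac (repr x)).2.
Proof.
rewrite -[LHS]reprK; set r := repr x; have r2 := denom_ratioP r.
unlock FracField.tofrac; rewrite -[X in _ * X]FracField.pi_inv.
rewrite -[RHS]FracField.pi_mul /FracField.mulf /FracField.invf /=.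
by rewrite !numden_Ratio ?oner_neq0 // mulr1 mul1r Ratio_numden.
Qed.

(** Links two descriptions of [F]: [subst_pow] uses the representative chosen by [repr], possibly
    unreduced, while [is_pole] speaks of a coprime fraction. The common factor [G] accounts for the
    difference. *)
Lemma ratfun_repr (F : ratfun) :
  exists P Q G : {poly rat},
    [/\ G != 0, Q != 0, coprimep P Q, F = P%:F / Q%:F
      & (frac (repr F)).1 = P * G /\ (frac (repr F)).2 = Q * G].
Proof.
set A := (frac _).1; set B := (frac _).2.
have B0 : B != 0 by apply: denom_ratioP.
have G0 : gcdp A B != 0 by rewrite gcdp_eq0 negb_and B0 orbT.
have eA := divpK (dvdp_gcdl A B); have eB := divpK (dvdp_gcdr A B).
exists (A %/ gcdp A B), (B %/ gcdp A B), (gcdp A B).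
have Q0 : B %/ gcdp A B != 0.
  by apply: contraNneq B0 => Q0; rewrite -eB Q0 mul0r.
split=> //; first by rewrite coprimep_div_gcd // B0 orbT.
transitivity ((A %/ gcdp A B * gcdp A B)%:F / (B %/ gcdp A B * gcdp A B)%:F).
  by rewrite eA eB; apply: fraction_repr.
by rewrite !rmorphM -mulf_div divff ?mulr1 // tofrac_eq0.
Qed.

(** * The local ring at a point and its evaluation map *)

Section Value.
Variables (C : numFieldType) (xi : C).
Implicit Types (F G : ratfun) (u v : C).

(** A relation expresses both membership in the local ring at [xi] and the value there; any fraction
    whose denominator does not vanish at [xi] may witness it, reduced or not. *)
Definition has_value F v := exists P Q : {poly rat},
  [/\ Q.<[xi]> != 0, F = P%:F / Q%:F & v = P.<[xi]> / Q.<[xi]>].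

Lemma eval_neq0 (Q : {poly rat}) : Q.<[xi]> != 0 -> Q%:F != 0.
Proof.
by apply: contraNneq => /eqP; rewrite tofrac_eq0 => /eqP->; rewrite rmorph0 horner0.
Qed.

Lemma has_value_poly (P : {poly rat}) : has_value P%:F P.<[xi]>.
Proof. by exists P, 1; rewrite !rmorph1 hornerC !divr1 oner_neq0. Qed.

(** Cross-multiplying the two fractions gives an identity of polynomials, which can be evaluated at
    [xi]. *)
Lemma has_value_unique F u v : has_value F u -> has_value F v -> u = v.
Proof.
move=> [P [Q [Q0 -> ->]]] [P' [Q' [Q'0 /eqP eqF ->]]].
apply/eqP; move: eqF; rewrite !eqr_div ?eval_neq0 // -!rmorphM tofrac_eq.
by move=> /eqP/(congr1 (fun p => p.<[xi]>)); rewrite !rmorphM !hornerM => ->.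
Qed.

Lemma has_valueD F G u v :
  has_value F u -> has_value G v -> has_value (F + G) (u + v).
Proof.
move=> [P [Q [Q0 -> ->]]] [P' [Q' [Q'0 -> ->]]].
exists (P * Q' + P' * Q), (Q * Q').
rewrite !(rmorphM, rmorphD) !(hornerM, hornerD) mulf_neq0 //.
by rewrite !addf_div ?eval_neq0.
Qed.

Lemma has_valueM F G u v :
  has_value F u -> has_value G v -> has_value (F * G) (u * v).
Proof.
move=> [P [Q [Q0 -> ->]]] [P' [Q' [Q'0 -> ->]]].
exists (P * P'), (Q * Q').
by rewrite !rmorphM !hornerM mulf_neq0 // !mulf_div.
Qed.

Lemma has_valueV F v : v != 0 -> has_value F v -> has_value F^-1 v^-1.
Proof.
move=> v0 [P [Q [Q0 -> ev]]]; move: v0; rewrite ev => v0.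
exists Q, P; rewrite !invf_div; split=> //.
by apply: contraNneq v0 => ->; rewrite mul0r.
Qed.

Lemma has_value0 : has_value 0 0.
Proof. by have := has_value_poly 0; rewrite !rmorph0 horner0. Qed.

Lemma has_value1 : has_value 1 1.
Proof. by have := has_value_poly 1; rewrite !rmorph1 hornerC. Qed.

Lemma has_valueN F v : has_value F v -> has_value (- F) (- v).
Proof.
have := has_value_poly (-1); rewrite !rmorphN !rmorph1 hornerN hornerC => hN.
by move=> /(has_valueM hN); rewrite !mulN1r.
Qed.

Lemma has_valueMz F v (n : int) : has_value F v -> has_value (F *~ n) (v *~ n).
Proof.
move=> hF; have hn k : has_value (F *+ k) (v *+ k).
  elim: k => [|k IHk]; first by rewrite !mulr0n; apply: has_value0.
  by rewrite !mulrS; apply: has_valueD.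
by case: n => n; [apply: hn | apply/has_valueN/hn].
Qed.

Lemma has_value_sum (I : eqType) (r : seq I) (F : I -> ratfun) (v : I -> C) :
  (forall i, i \in r -> has_value (F i) (v i)) ->
  has_value (\sum_(i <- r) F i) (\sum_(i <- r) v i).
Proof.
move=> h; rewrite !big_seq; elim/big_ind2: _ => //; first exact: has_value0.
by move=> *; apply: has_valueD.
Qed.

Lemma has_value_exprz F v (n : int) :
  v != 0 -> has_value F v -> has_value (F ^ n) (v ^ n).
Proof.
move=> v0 hF; have hn k : has_value (F ^+ k) (v ^+ k).
  elim: k => [|k IHk]; first by rewrite !expr0; apply: has_value1.
  by rewrite !exprS; apply: has_valueM.
by case: n => n; [apply: hn | apply: has_valueV => //; rewrite expf_neq0].
Qed.

Lemma has_value_eval (P : {poly rat}) F v :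
  has_value F v -> has_value (eval_ratfun P F) P.<[v]>.
Proof.
move=> hF; elim/poly_ind: P => [|P c IHP].
  by rewrite /eval_ratfun !map_poly0 !horner0; apply: has_value0.
have -> : eval_ratfun (P * 'X + c%:P) F = eval_ratfun P F * F + c%:P%:F.
  rewrite /eval_ratfun -![map_poly _ _]/(map_poly constF _).
  by rewrite rmorphD rmorphM /= map_polyX map_polyC hornerMXaddC.
rewrite rmorphD rmorphM /= map_polyX map_polyC hornerMXaddC.
apply: has_valueD; first exact: has_valueM.
by have := has_value_poly c%:P; rewrite map_polyC hornerC.
Qed.

End Value.

(** * Substitution of powers of the indeterminate *)

Lemma eval_ratfunM (P Q : {poly rat}) (y : ratfun) :
  eval_ratfun (P * Q) y = eval_ratfun P y * eval_ratfun Q y.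
Proof.
rewrite /eval_ratfun -![map_poly _ _]/(map_poly constF _).
by rewrite rmorphM hornerM.
Qed.

Lemma eval_ratfun_poly (P Q : {poly rat}) : eval_ratfun P Q%:F = (P \Po Q)%:F.
Proof.
by rewrite /eval_ratfun /comp_poly -horner_map /= -map_poly_comp.
Qed.

(** This is the transcendence of ['X ^ m] over the rationals. For positive [m], composing with a
    nonconstant polynomial kills no nonzero polynomial. *)
Lemma eval_ratfun_exprz_neq0 (P : {poly rat}) (m : int) :
  m != 0 -> P != 0 -> eval_ratfun P ('X%:F ^ m) != 0.
Proof.
have pos (Q : {poly rat}) n : Q != 0 -> eval_ratfun Q ('X%:F ^+ n.+1) != 0.
  move=> Q0; rewrite -rmorphXn eval_ratfun_poly tofrac_eq0.
  by rewrite comp_poly_eq0 // size_polyXn.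
case: m => [[|n]|n] // _ P0; first exact: pos.
apply/negP => evP0.
(* If a negative power of ['X] were algebraic, so would be its inverse, a positive power. *)
have [|Q Q0 rootQ] := @algebraic_inv _ _ constF ('X%:F ^ Negz n).
  by exists P.
by move: rootQ; rewrite /= invrK => rootQ; case/negP: (pos Q n Q0).
Qed.

(** The function [v] is chosen before [xi] and [m], so the value depends on them only through
    [xi ^ m]; this is what later allows exponents to be reduced modulo [d]. *)
Lemma has_value_subst_pow (C : numFieldType) (F : ratfun) :
  exists v : C -> C, forall (xi : C) (m : int),
    xi != 0 -> m != 0 -> defined_at F (xi ^ m) ->
    has_value xi (subst_pow m F) (v (xi ^ m)).
Proof.
have [P [Q [G [G0 Q0 copPQ eqF [eqA eqB]]]]] := ratfun_repr F.
exists (fun y => P.<[y]> / Q.<[y]>) => xi m xi0 m0 Fdef.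
have hX : has_value xi ('X%:F ^ m) (xi ^ m).
  apply: has_value_exprz => //.
  by have := has_value_poly xi 'X; rewrite map_polyX hornerX.
have Qy0 : Q.<[xi ^ m]> != 0.
  by apply/negP => Qy; apply: Fdef; exists P, Q.
(* The factor [G] cancels as a nonzero rational function, even if it vanishes at [xi ^ m]. *)
have -> : subst_pow m F = eval_ratfun P ('X%:F ^ m) / eval_ratfun Q ('X%:F ^ m).
  rewrite /subst_pow eqA eqB !eval_ratfunM -mulf_div divff ?mulr1 //.
  exact: eval_ratfun_exprz_neq0.
by apply: has_valueM; [|apply: has_valueV => //]; apply: has_value_eval.
Qed.

(** * Additive maps out of a monoid ring, and reduction of exponents *)

Section LinearExtension.
Variables (V : zmodType) (M : monoidType).

Definition mr_lin (w : M -> V) (g : monoid_ring M) : V :=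
  \sum_(k <- supp g) w k *~ g@_k.

Lemma mr_linw (w : M -> V) (D : {fset M}) (g : monoid_ring M) :
  msupp g `<=` D -> mr_lin w g = \sum_(k <- D) w k *~ g@_k.
Proof.
move=> le_D; apply: big_fset_incl => //= k _ /mcoeff_outdom ->.
by rewrite mulr0z.
Qed.

Lemma mr_linD (w : M -> V) : {morph mr_lin w : g h / g + h}.
Proof.
move=> g h; rewrite (mr_linw w (msuppD_le g h)).
rewrite (mr_linw w (fsubsetUl (msupp g) (msupp h))).
rewrite (mr_linw w (fsubsetUr (msupp g) (msupp h))) -big_split.
by apply: eq_bigr => k _; rewrite mcoeffD mulrzDr.
Qed.

Lemma mr_lin0 (w : M -> V) : mr_lin w 0 = 0.
Proof. by rewrite /mr_lin /supp msupp0 big_seq_fset0. Qed.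

Lemma mr_lin_bracket (w : M -> V) (c : int) (k : M) :
  mr_lin w (bracket c k) = w k *~ c.
Proof. by rewrite (mr_linw w msuppU_le) big_seq_fset1 mcoeffUU. Qed.

End LinearExtension.

(** Lets a sum over the support of [g] be read off from its image, although [h] may merge terms or
    make them cancel. *)
Lemma mr_lin_map (V : zmodType) (M N : monoidType) (h : M -> N) (w : N -> V)
    (g : monoid_ring M) :
  mr_lin w (mr_map h g) = mr_lin (w \o h) g.
Proof.
rewrite /mr_map (big_morph _ (mr_linD w) (mr_lin0 w)).
by apply: eq_bigr => k _; rewrite mr_lin_bracket.
Qed.

Lemma prim_exprz_residue (C : fieldType) (d : nat) (z : C) (m : nzint) :
  (1 < d)%N -> d.-primitive_root z ->
  z ^+ (residue d m : 'Z_d) = z ^ val m.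
Proof.
move=> d1 pz; have d0 : d%:Z != 0 by case: d d1 {pz}.
have z0 : z != 0 by rewrite (prim_root_eq0 pz) -lt0n ltnW.
rewrite /residue {2}(divz_eq (val m) d) {1}(divz_eq (val m) d).
have: (0 <= val m %% d)%Z by apply: modz_ge0.
case: (_ %% _)%Z => // n _.
(* The multiple of [d] in the Euclidean division of [val m] vanishes in ['Z_d], and it contributes a
   factor 1 to the power of [z]; only the remainder [n] is left on both sides. *)
rewrite intrD intrM -!pmulrn pchar_Zp // mulr0 add0r.
rewrite expfzDr // [_ * d%:Z]mulrC -exprz_exp -exprnP (prim_expr_order pz) exp1rz mul1r.
by rewrite val_Zp_nat // (prim_expr_mod pz).
Qed.

(** * Cyclotomic polynomials as minimal polynomials *)

Section CyclotomicRoots.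
Variables (C : numFieldType) (d : nat) (z : C).
Hypothesis prim_z : d.-primitive_root z.

Lemma map_Phi_rat (K : numFieldType) n :
  map_poly ratr (Phi_rat n) = map_poly intr 'Phi_n :> {poly K}.
Proof.
by rewrite /Phi_rat -map_poly_comp; apply: eq_map_poly => c /=; rewrite ratr_int.
Qed.

Lemma root_Phi_rat : root (map_poly ratr (Phi_rat d)) z.
Proof.
have d0 := prim_order_gt0 prim_z.
have: root (map_poly intr ('X^d - 1)) z.
  by rewrite rmorphB /= map_polyXn rmorph1 rootE !hornerE (prim_expr_order prim_z) subrr.
(* As a root of ['X^d - 1], [z] is a root of ['Phi_e] for some divisor [e] of [d]. Then
   [z ^+ e = 1], so [d] divides [e] as well. *)
rewrite -(prod_Cyclotomic d0) rmorph_prod rootE horner_prod.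
rewrite prodf_seq_eq0 => /hasP[e]; rewrite -dvdn_divisors // => ed /= Phie.
have e0 : (0 < e)%N by apply: dvdn_gt0 ed.
suff -> : d = e by rewrite map_Phi_rat.
apply/eqP; rewrite eqn_dvd ed andbT (prim_order_dvd prim_z).
have: root (map_poly intr ('X^e - 1)) z.
  rewrite -(prod_Cyclotomic e0) rmorph_prod rootE horner_prod.
  rewrite prodf_seq_eq0; apply/hasP; exists e => //.
  by rewrite -dvdn_divisors.
by rewrite rmorphB /= map_polyXn rmorph1 rootE !hornerE subr_eq0.
Qed.

(** Irreducibility over the rationals does not involve [C], so it can be proved with a primitive
    root [y] in [algC], whose minimal polynomial is cyclotomic. *)
Lemma irreducible_Phi_rat : irreducible_poly (Phi_rat d).
Proof.
have [y prim_y] := C_prim_root_exists (prim_order_gt0 prim_z).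
have [p [ep mon_p dv_p]] := minCpolyP y.
have -> : Phi_rat d = p.
  apply: (map_poly_inj (ratr : {rmorphism rat -> algC})).
  by rewrite -ep map_Phi_rat (Cintr_Cyclotomic prim_y) (minCpoly_cyclotomic prim_y).
have py : root (map_poly ratr p) y by rewrite dv_p.
apply/(subfx_irreducibleP py (monic_neq0 mon_p)) => q qy q0.
by rewrite dvdp_leq // -dv_p.
Qed.

Lemma Phi_rat_dvd (P : {poly rat}) :
  (Phi_rat d %| P) = root (map_poly ratr P) z.
Proof.
apply/idP/idP => [/dvdpP[q ->]|Pz].
  by rewrite rmorphM rootM root_Phi_rat orbT.
have gz : root (map_poly ratr (gcdp (Phi_rat d) P)) z.
  by rewrite gcdp_map root_gcd root_Phi_rat.
(* The gcd has the root [z], hence is not constant, and irreducibility makes it associate to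
   [Phi_rat d]. *)
have [_ /(_ (gcdp (Phi_rat d) P)) irr] := irreducible_Phi_rat.
rewrite -(eqp_dvdl _ (irr _ (dvdp_gcdl _ _))) ?dvdp_gcdr //.
apply/negP => /size_poly1P[c c0 gc]; move: gz.
by rewrite gc map_polyC rootC fmorph_eq0 (negPf c0).
Qed.

End CyclotomicRoots.

Theorem theorem1p2 (R : realType) (f : ratfun) (d : nat) (zeta : R[i])
    (alpha : ZZo) :
  (1 < d)%N ->
  d.-primitive_root zeta ->
  (exists beta : ZZo,
    [/\ Ann f beta,
        phi d alpha = phi d beta
      & forall a : nzint, a \in supp alpha `|` supp beta ->
          defined_at f (zeta ^ val a)]) ->
  is_factor (Phi_rat d) (act alpha f).
Proof.
move=> d1 pz [beta [annf eqphi fdef]].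
have z0 : zeta != 0 by rewrite (prim_root_eq0 pz) -lt0n ltnW.
have [v hv] := has_value_subst_pow R[i] f.
pose w (r : mulmonoid 'Z_d) := v (zeta ^+ (r : 'Z_d)).
(* The value of [act g f] at [zeta] is expressed through [phi d g] alone, so [alpha] and [beta]
   yield the same value. *)
have hact g : supp g `<=` supp alpha `|` supp beta ->
    has_value zeta (act g f) (mr_lin w (phi d g)).
  move=> /fsubsetP sg; rewrite mr_lin_map; apply: has_value_sum => m /sg mS.
  rewrite /= /w prim_exprz_residue //.
  by apply: has_valueMz; apply: hv => //; [apply: (valP m) | apply: fdef].
have := hact alpha (fsubsetUl _ _); rewrite eqphi.
have := hact beta (fsubsetUr _ _); rewrite annf.
(* The common value is 0 because [beta] annihilates [f]. The fraction witnessing this for [alpha]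
   vanishes at [zeta] in its numerator only. *)
move=> /(has_value_unique (has_value0 zeta)) <- [P [Q [Qz eqf /esym/eqP]]].
rewrite mulf_eq0 invr_eq0 (negPf Qz) orbF => Pz.
by exists P, Q; rewrite !(Phi_rat_dvd pz).
Qed.
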